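(* For any primitive set $A\subset\mathbb{Z}_{>1}$ we have $f(A)\le f(\mathcal P)$, where $f(A)=\sum_{a\in A}\frac{1}{a\log a}$ and $\mathcal P$ is the set of prime numbers.
   Context: A set $A\subset\mathbb{Z}_{>1}$ is primitive if no member of $A$ divides another member of $A$. For a set $A\subset\mathbb{Z}_{>1}$, $f(A)=\sum_{a\in A}\frac{1}{a\log a}$. *)

(* Defs.v *)
From HB Require Import structures.
From mathcomp Require Import all_boot all_order all_algebra.
From mathcomp Require Import all_classical all_reals all_analysis.
Set Implicit Arguments. Unset Strict Implicit. Unset Printing Implicit Defensive.
Import Order.TTheory GRing.Theory Num.Theory.
Local Open Scope classical_set_scope.
Local Open Scope ring_scope.

Definition primitive_set (A : set nat) : Prop :=
  (forall a, A a -> (1 < a)%N) /\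
  (forall a b, A a -> A b -> (a %| b)%N -> a = b).

Definition ferdos (R : realType) (A : set nat) : \bar R :=
  (\esum_(a in A) ((a%:R * ln (a%:R : R))^-1)%:E)%E.

Definition primes_set : set nat := [set p | prime p].

(* Main.v *)
(* Let L be the von Mangoldt function and nu(n) = 1 / (n ln n). Since the L(d),
   d | n, add up to ln n, there is a Markov chain going from n to n / d with
   probability L(d) / ln n; a slight change at prime powers makes it end at a
   prime. Mertens' bound  sum_(q <= x) L(q) / q <= ln x  and summation by parts
   give  sum_q L(q) / (q ln^2 (n q)) <= 1 / ln n,  with enough room to absorb the
   change at prime powers: the measure nu is subinvariant. Start the chain from
   the points of a finite primitive set A with masses nu(a). As no point of A lies
   below another one, subinvariance keeps the mass at each n below nu(n); but all
   the mass ends at the primes, so nu(A) is at most the nu-mass of the primes. *)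
From Stdlib Require BinNat.
Require Import Defs.
From mathcomp Require Import all_boot all_order all_algebra.
From mathcomp Require Import all_classical all_reals all_analysis.
From mathcomp Require Import zify ring lra.

Set Implicit Arguments. Unset Strict Implicit. Unset Printing Implicit Defensive.
Import Order.TTheory GRing.Theory Num.Theory.
Local Open Scope ring_scope.

(** * The von Mangoldt function *)

Definition mangoldt (R : realType) (n : nat) : R :=
  if (1 < n)%N && (n == (pdiv n) ^ (logn (pdiv n) n))%N
  then ln (pdiv n)%:R else 0.

Section VonMangoldt.
Context {R : realType}.
Local Notation L := (@mangoldt R).
Local Notation lnn n := (ln (n%:R : R)).

Lemma lnn_ge0 n : 0 <= lnn n.
Proof.
by case: n => [|n]; [rewrite ln0 | rewrite ln_ge0 // ler1n].
Qed.

Lemma lnn_gt0 n : (1 < n)%N -> 0 < lnn n.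
Proof. by move=> n1; rewrite ln_gt0 // ltr1n. Qed.

Lemma lnnM m n : (0 < m)%N -> (0 < n)%N -> lnn (m * n) = lnn m + lnn n.
Proof. by move=> m0 n0; rewrite natrM lnM // posrE ltr0n. Qed.

Lemma ler_lnn m n : (0 < m)%N -> (m <= n)%N -> lnn m <= lnn n.
Proof.
move=> m0 mn; rewrite ler_ln ?ler_nat // posrE ltr0n //.
exact: leq_trans m0 mn.
Qed.

Lemma lnnX m k : (0 < m)%N -> lnn (m ^ k) = lnn m *+ k.
Proof. by move=> m0; rewrite natrX lnXn // ltr0n. Qed.

Lemma mangoldt_pfactor p k : prime p -> L (p ^ k.+1) = lnn p.
Proof.
move=> pp; rewrite /mangoldt pdiv_pfactor // pfactorK // eqxx andbT.
by rewrite -{1}(expn0 p) ltn_exp2l ?prime_gt1.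
Qed.

Lemma mangoldt_neq0 n :
  L n != 0 -> exists p k, prime p /\ n = (p ^ k.+1)%N.
Proof.
rewrite /mangoldt; case: ifP; last by rewrite eqxx.
move=> /andP[n1 /eqP e] _; exists (pdiv n), (logn (pdiv n) n).-1.
rewrite pdiv_prime //; split=> //.
by rewrite prednK // logn_gt0 mem_primes pdiv_prime // pdiv_dvd (ltnW n1).
Qed.

Lemma mangoldt_ge0 n : 0 <= L n.
Proof. by rewrite /mangoldt; case: ifP => // _; exact: lnn_ge0. Qed.

Lemma mangoldt1 : L 1 = 0.
Proof. by rewrite /mangoldt. Qed.

Lemma sum_nat_pred1 (F : nat -> R) m n i :
  (m <= i < n)%N -> \sum_(m <= j < n) (if i == j then F j else 0) = F i.
Proof.
move=> /andP[mi ijn]; rewrite (bigD1_seq i) ?iota_uniq //=; last first.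
  by rewrite mem_index_iota mi.
by rewrite eqxx big1 ?addr0 // => j; rewrite eq_sym => /negbTE ->.
Qed.

(** Strip the full power p^k of the least prime factor: n = m p^k, and the prime powers dividing n
    are those dividing m together with p, ..., p^k. The cutoff N is separate from n, so the
    induction stays within one range. *)
Lemma sum_mangoldt_dvd n N : (0 < n <= N)%N ->
  \sum_(1 <= d < N.+1 | (d %| n)%N) L d = lnn n.
Proof.
elim/ltn_ind: n => n IH /andP[n0 nN].
have [n1|n1] := leqP n 1.
  have {n1 n0 IH nN} -> : n = 1%N by lia.
  rewrite ln1 big1 // => d; rewrite dvdn1 => /eqP ->; exact: mangoldt1.
set p := pdiv n; have pp : prime p := pdiv_prime n1.
have [m cpm nE] := pfactor_coprime pp n0; set k := logn p n in nE.
have k0 : (0 < k)%N.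
  by rewrite logn_gt0 mem_primes pp n0 pdiv_dvd.
have m0 : (0 < m)%N by move: n0; rewrite nE muln_gt0 => /andP[].
have pk1 : (1 < p ^ k)%N by rewrite -{1}(expn0 p) ltn_exp2l ?prime_gt1.
have mn : (m < n)%N by rewrite nE -{1}(muln1 m) ltn_pmul2l.
have main d : (if (d %| n)%N then L d else 0) = (if (d %| m)%N then L d else 0)
    + \sum_(1 <= j < k.+1) (if d == (p ^ j)%N then lnn p else 0).
  have [L0|/mangoldt_neq0[q [i [qq ->]]]] := eqVneq (L d) 0.
    rewrite L0 !if_same add0r big_nat big1 // => -[//|j] _.
    case: eqP => // dE; have := lnn_gt0 (prime_gt1 pp).
    by rewrite -(mangoldt_pfactor j pp) -dE L0 ltxx.
  rewrite mangoldt_pfactor //; have [->|qp] := eqVneq q p.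
    have /negbTE -> : ~~ (p ^ i.+1 %| m)%N.
      apply/negP => dm; move: cpm; rewrite prime_coprime // => /negP; apply.
      by apply: dvdn_trans dm; rewrite expnS dvdn_mulr.
    rewrite pfactor_dvdn // -/k add0r.
    have E j : (p ^ i.+1 == p ^ j)%N = (i.+1 == j).
      by rewrite eqn_exp2l // prime_gt1.
    under eq_bigr => j _ do rewrite E.
    case: ifP => ik; first by rewrite sum_nat_pred1.
    rewrite big_nat big1 // => j /andP[_ jk]; case: eqP => // ij.
    by move: ik; rewrite ij -ltnS jk.
  have cq : coprime (q ^ i.+1) (p ^ k).
    by rewrite coprimeXl // coprimeXr // prime_coprime // dvdn_prime2.
  rewrite nE Gauss_dvdl // big_nat big1 ?addr0 // => -[//|j] _.
  case: eqP => // e; have : (q %| p ^ j.+1)%N by rewrite -e expnS dvdn_mulr.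
  by rewrite Euclid_dvdX // dvdn_prime2 // (negbTE qp).
rewrite big_mkcond (eq_bigr _ (fun d _ => main d)) big_split /= -big_mkcond.
rewrite IH //; last by rewrite m0 ltnW // (leq_trans mn).
rewrite exchange_big /= nE lnnM // ?(ltnW pk1) // lnnX ?prime_gt0 //.
congr (_ + _); rewrite big_nat (eq_bigr (fun=> lnn p)).
  by rewrite -big_nat sumr_const_nat subn1.
move=> j /andP[j1 jk].
under eq_bigr => d _ do rewrite eq_sym.
rewrite (sum_nat_pred1 (fun=> lnn p)) // expn_gt0 prime_gt0 //=.
rewrite ltnS; apply: leq_trans nN; rewrite nE.
by apply: leq_trans (leq_pmull _ m0); rewrite leq_exp2l ?prime_gt1.
Qed.

(** Legendre's formula in logarithmic form: passing from n to n + 1 raises the quotient by q by one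
    exactly when q divides n + 1. *)
Lemma ln_fact_mangoldt n N : (n <= N)%N ->
  lnn n`! = \sum_(1 <= q < N.+1) L q * (n %/ q)%:R.
Proof.
elim: n => [|n IH] nN.
  by rewrite ln1 big1 // => q _; rewrite div0n mulr0.
rewrite factS lnnM ?fact_gt0 // IH ?(ltnW nN) // -(@sum_mangoldt_dvd _ N) //.
rewrite big_mkcond -big_split /= big_nat [RHS]big_nat.
apply: eq_bigr => q /andP[q0 _]; rewrite divnS // natrD mulrDr.
by case: (q %| n.+1)%N; rewrite ?mulr1 ?mulr0.
Qed.

End VonMangoldt.

(** * Mertens' upper bound *)

Section Mertens.
Context {R : realType}.
Local Notation L := (@mangoldt R).
Local Notation lnn n := (ln (n%:R : R)).

(** The row of the coefficient sums to 2^(a+b). For a = b one entry is bounded by the whole row; for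
    a = b + 1 two equal middle entries share it. *)
Lemma bin_half_bound a b : (b <= a <= b.+1)%N -> ('C(a + b, a) <= 4 ^ b)%N.
Proof.
have bin_sum n : (\sum_(i < n.+1) 'C(n, i) = 2 ^ n)%N.
  rewrite -[2%N]/(1 + 1)%N expnDn; apply: eq_bigr => i _.
  by rewrite !exp1n !muln1.
have E : (4 ^ b = 2 ^ (b + b))%N by rewrite addnn -mul2n expnM.
case/andP => ba ab1; have [->|ab] := eqVneq a b.
  have bb : (b < (b + b).+1)%N by lia.
  by rewrite E -bin_sum (bigD1 (Ordinal bb)) //= leq_addr.
have {ba ab1 ab} -> : a = b.+1 by lia.
have b1 : (b < (b.+1 + b).+1)%N by lia.
have b2 : (b.+1 < (b.+1 + b).+1)%N by lia.
rewrite -(@leq_pmul2l 2) // E -expnS -addSn -bin_sum.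
rewrite (bigD1 (Ordinal b1)) //= (bigD1 (Ordinal b2)) /=; last first.
  by rewrite -val_eqE /=; lia.
have -> : 'C(b.+1 + b, b) = 'C(b.+1 + b, b.+1).
  by rewrite -[RHS]bin_sub ?leq_addr // addKn.
by rewrite addnA mul2n -addnn leq_addr.
Qed.

(** Chebyshev's argument: by [ln_fact_mangoldt] the logarithm of the binomial coefficient is a sum
    of L(q) with nonnegative coefficients, which are at least 1 for a < q <= a + b. *)
Lemma sum_mangoldt_bin a b : (b <= a)%N ->
  \sum_(1 <= q < (a + b).+1) L q <=
  \sum_(1 <= q < a.+1) L q + lnn 'C(a + b, a).
Proof.
move=> ba.
have /(congr1 (fun n => lnn n)) := bin_fact (leq_addr b a).
rewrite addKn !lnnM ?muln_gt0 ?fact_gt0 ?bin_gt0 ?leq_addr //.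
rewrite (@ln_fact_mangoldt _ a (a + b)) ?leq_addr //.
rewrite (@ln_fact_mangoldt _ b (a + b)) ?leq_addl //.
rewrite (@ln_fact_mangoldt _ (a + b) (a + b)) // -big_split /=.
move/(canRL (addrK _)) => ->; rewrite -sumrB.
rewrite (@big_cat_nat _ _ _ a.+1 1 (a + b).+1) //= ?ltnS ?leq_addr //.
rewrite lerD2l [leRHS](@big_cat_nat _ _ _ a.+1) //= ?ltnS ?leq_addr //.
have term q : (0 < q)%N -> (a %/ q + b %/ q <= (a + b) %/ q)%N.
  move=> q0; rewrite leq_divRL // mulnDl leq_add ?leq_trunc_div //.
rewrite -[leLHS]add0r lerD //.
  rewrite big_nat; apply: sumr_ge0 => q /andP[q0 _].
  by rewrite -mulrDr -mulrBr mulr_ge0 ?mangoldt_ge0 // -natrD subr_ge0 ler_nat term.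
rewrite big_nat [leRHS]big_nat; apply: ler_sum => q /andP[aq qab].
rewrite (divn_small aq) (divn_small (leq_ltn_trans ba aq)) !mulr0 !addr0 subr0.
by rewrite ler_peMr ?mangoldt_ge0 // ler1n divn_gt0 //; lia.
Qed.

(** Chebyshev's bound, by halving: induction at the larger half a gives a ln 4, and the middle
    binomial coefficient adds at most b ln 4. *)
Lemma sum_mangoldt_le n : \sum_(1 <= q < n.+1) L q <= n%:R * lnn 4.
Proof.
elim/ltn_ind: n => n IH; have [n1|n1] := leqP n 1.
  rewrite big_nat big1 ?mulr_ge0 ?lnn_ge0 // => q /andP[q0 qn].
  by rewrite (_ : q = 1)%N ?mangoldt1 //; lia.
have [a [b [nE ba ab]]] : exists a b, [/\ n = a + b, b <= a & a <= b.+1]%N.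
  by exists (n - n./2)%N, n./2; split; lia.
have an : (a < n)%N by lia.
rewrite nE; apply: le_trans (sum_mangoldt_bin ba) _.
rewrite natrD mulrDl lerD ?IH //.
rewrite mulr_natl -lnnX //; apply: ler_lnn; last first.
  by apply: bin_half_bound; rewrite ba.
by rewrite bin_gt0 leq_addr.
Qed.

(** Summation by parts: the partial sums [D] of v - w are nonnegative and g decreases, so the two
    sides differ by at least D(N) g(N) >= 0. *)
Lemma ler_sum_dominated (w v g : nat -> R) N :
  (forall m, \sum_(1 <= q < m.+1) w q <= \sum_(1 <= q < m.+1) v q) ->
  (forall m, (0 < m)%N -> g m.+1 <= g m) -> 0 <= g N ->
  \sum_(1 <= q < N.+1) w q * g q <= \sum_(1 <= q < N.+1) v q * g q.
Proof.
move=> wv gdec gN; have [->|N0] := posnP N; first by rewrite !big_geq.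
pose D m := \sum_(1 <= q < m.+1) (v q - w q).
have D0 m : 0 <= D m by rewrite /D sumrB subr_ge0.
have DS m : D m.+1 = D m + (v m.+1 - w m.+1) by rewrite /D big_nat_recr.
have key m : (0 < m)%N ->
    D m * g m <= \sum_(1 <= q < m.+1) (v q - w q) * g q.
  elim: m => // -[|m] IH _; first by rewrite /D !big_nat1.
  rewrite big_nat_recr //= DS mulrDl lerD2r.
  by apply: le_trans (IH _) => //; rewrite ler_wpM2l // gdec.
rewrite -subr_ge0 -sumrB; apply: le_trans (mulr_ge0 (D0 N) gN) _.
apply: le_trans (key N N0) _; apply: ler_sum => q _.
by rewrite mulrBl.
Qed.

(** This is ln(1 - x) <= -x at x = 1/(n+1). *)
Lemma invr_le_lnn_diff n : (0 < n)%N -> (n.+1%:R)^-1 <= lnn n.+1 - lnn n.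
Proof.
move=> n0; rewrite -opprB lerNr -ln_div ?posrE ?ltr0n //.
have -> : n%:R / n.+1%:R = 1 + - (n.+1%:R)^-1 :> R.
  by rewrite -(addrK 1 n%:R) -natr1 mulrBl divff ?mul1r // natr1 pnatr_eq0.
apply: le_ln1Dx; rewrite ltrN2 invf_lt1 ?ltr0n // ltr1n; lia.
Qed.

Lemma sum_lnn_diff (h n : nat) : (h <= n)%N ->
  \sum_(h <= q < n) (lnn q.+1 - lnn q) = lnn n - lnn h.
Proof. by move=> hn; rewrite (telescope_sumr (fun q => lnn q)). Qed.

Lemma sum_invr_dyadic h : \sum_(h.+1 <= q < (h + h).+1) (q%:R)^-1 <= lnn 2.
Proof.
have [->|h0] := posnP h; first by rewrite big_geq // lnn_ge0.
rewrite big_add1 /= big_nat.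
apply: le_trans (_ : _ <= \sum_(h <= q < h + h) (lnn q.+1 - lnn q)) _.
  rewrite [leRHS]big_nat; apply: ler_sum => q /andP[hq _].
  by apply: invr_le_lnn_diff; lia.
rewrite sum_lnn_diff ?leq_addr // addnn -mul2n lnnM //.
by rewrite addrK.
Qed.

(** The induction step from n to n + 1 amounts to (n+1)(ln(n+1) - ln n) >= 1. *)
Lemma ln_fact_le n : (0 < n)%N ->
  lnn n`! <= n%:R * lnn n - n%:R + 1 + lnn n.
Proof.
elim: n => // -[|n] IH _; first by rewrite factS fact0 ln1; lra.
rewrite factS lnnM ?fact_gt0 //.
have := IH isT; have := @invr_le_lnn_diff n.+1 isT.
move: (lnn n.+1) (lnn n.+2) (lnn n.+1`!) => x y z h1 h2.
have h3 : 1 <= n.+2%:R * (y - x).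
  by move: h1; rewrite -(ler_pM2l (_ : 0 < n.+2%:R)) ?ltr0n // divff ?pnatr_eq0.
move: h2 h3; rewrite -(natr1 n.+1); move: (n.+1%:R : R) => t; nra.
Qed.

(* The fractional part of [N / q] is at most [min(1, N / q - 1)], which, unlike
   the fractional part, is monotone in [q]. *)
Lemma sum_mangoldt_frac_le N : (0 < N)%N ->
  \sum_(1 <= q < N.+1) L q * (N%:R / q%:R - (N %/ q)%:R) <=
  N%:R * (lnn 4 * lnn 2).
Proof.
move=> N0; pose phi q : R := Num.min 1 (N%:R / q%:R - 1).
have Nq q : (0 < q)%N -> N%:R / q%:R = (N %/ q)%:R + (N %% q)%:R / q%:R :> R.
  move=> q0; rewrite {1}(divn_eq N q) natrD natrM mulrDl mulfK //.
  by rewrite pnatr_eq0; lia.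
apply: le_trans (_ : _ <= \sum_(1 <= q < N.+1) L q * phi q) _.
  rewrite big_nat [leRHS]big_nat; apply: ler_sum => q /andP[q0 qN].
  rewrite ler_wpM2l ?mangoldt_ge0 // /phi le_min; apply/andP; split.
    rewrite Nq // addrC addKr ler_pdivrMr ?ltr0n // mul1r ler_nat.
    by rewrite ltnW // ltn_mod.
  by rewrite lerD2l lerN2 ler1n divn_gt0.
have phi_dec m : (0 < m)%N -> phi m.+1 <= phi m.
  move=> m0; rewrite /phi le_min !ge_min lexx /=.
  apply/orP; right; rewrite lerD2r ler_wpM2l // lef_pV2 ?posrE ?ltr0n //.
  by rewrite ler_nat.
apply: le_trans (ler_sum_dominated (v := fun=> lnn 4) _ phi_dec _) _.
- by move=> m; rewrite sumr_const_nat subn1 -[leRHS]mulr_natl sum_mangoldt_le.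
- by rewrite /phi divff ?pnatr_eq0 -?lt0n // subrr le_min lexx ler01.
rewrite -mulr_sumr mulrCA ler_wpM2l ?lnn_ge0 //.
(* Up to h the bound 1 is used for [phi], beyond h the bound N/q - 1. The h ones cancel the h
   subtracted ones, leaving N times a harmonic sum over h < q <= 2h. *)
pose h := N./2.
have hN : (h <= N)%N by rewrite /h; lia.
rewrite (@big_cat_nat _ _ _ h.+1) //=.
apply: le_trans (_ : _ <= h%:R + \sum_(h.+1 <= q < N.+1) (N%:R / q%:R - 1)) _.
  apply: lerD; last by apply: ler_sum => q _; rewrite /phi ge_min lexx orbT.
  apply: le_trans (_ : _ <= \sum_(1 <= q < h.+1) 1) _.
    by apply: ler_sum => q _; rewrite /phi ge_min lexx.
  by rewrite sumr_const_nat subn1.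
(* For odd N the extra term q = N is N/N - 1 = 0. *)
have -> : \sum_(h.+1 <= q < N.+1) (N%:R / q%:R - 1) =
          \sum_(h.+1 <= q < (h + h).+1) (N%:R / q%:R - 1) :> R.
  have [->//|NE] : (N = h + h \/ N = (h + h).+1)%N by rewrite /h; lia.
  rewrite {2}NE big_nat_recr /=; last by lia.
  by rewrite -NE divff ?pnatr_eq0 -?lt0n // subrr addr0.
rewrite sumrB -mulr_sumr sumr_const_nat subSS addnK addrC subrK.
by rewrite ler_wpM2l // sum_invr_dyadic.
Qed.

(** The first four terms of the exponential series at 7/10 already exceed 2. *)
Lemma ln2_le : lnn 2 <= 7 / 10.
Proof.
have x0 : 0 < 7 / 10 :> R by lra.
rewrite -ler_expR lnK ?posrE ?ltr0n //.
apply: le_trans (_ : _ <= series (exp_coeff (7 / 10 : R)) 4) _.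
  rewrite /series /= /exp_coeff /= !big_nat_recr //= big_geq //.
  rewrite (_ : 3`! = 6)%N // (_ : 2`! = 2)%N // !factS !fact0 !exprS expr0; lra.
apply: nondecreasing_cvgn_le; last exact: is_cvg_series_exp_coeff.
apply/nondecreasing_seqP => n; rewrite /series /= big_nat_recr //= lerDl.
by rewrite exp_coeff_ge0 // ltW.
Qed.

(* Here [ln N! <= N ln N - N + 1 + ln N] and [sum_mangoldt_frac_le] leave
   the room [N (1 - 2 (ln 2)^2) >= N / 50], which exceeds [1 + ln N] from 350 on. *)
Lemma mertens_large N : (350 <= N)%N ->
  \sum_(1 <= q < N.+1) L q / q%:R <= lnn N.
Proof.
move=> N350; have N0 : (0 < N)%N by lia.
have NR : 0 < N%:R :> R by rewrite ltr0n.
rewrite -(ler_pM2l NR) mulr_sumr.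
have -> : \sum_(1 <= q < N.+1) N%:R * (L q / q%:R) =
    lnn N`! + \sum_(1 <= q < N.+1) L q * (N%:R / q%:R - (N %/ q)%:R).
  rewrite (@ln_fact_mangoldt _ N N) // -big_split /=; apply: eq_bigr => q _.
  by rewrite -mulrDr addrC subrK mulrCA.
apply: le_trans (lerD (ln_fact_le N0) (sum_mangoldt_frac_le N0)) _.
have ln4 : lnn 4 = lnn 2 + lnn 2 by rewrite -lnnM.
have l512 : lnn 512 = lnn 2 *+ 9 by rewrite -lnnX.
(* The tangent of ln at 512, a power of 2 not far from the threshold, reduces ln N to ln 2 and a
   linear term in N. *)
have lN : lnn N <= lnn 512 + (N%:R / 512 - 1).
  rewrite -lerBlDl -ln_div ?posrE ?ltr0n // -{1}(subrK 1 (N%:R / 512)) addrC.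
  by apply: le_ln1Dx; lra.
have l2 := ln2_le; have l20 : 0 <= lnn 2 := lnn_ge0 2.
have sq : lnn 4 * lnn 2 <= 98 / 100.
  rewrite ln4; move: l2 l20; move: (lnn 2) => x x1 x2.
  have := ler_pM x2 x2 x1 x1; lra.
have NR350 : 350 <= N%:R :> R by rewrite ler_nat.
have := ler_wpM2l (ltW NR) sq; rewrite l512 in lN.
move: (N%:R * (lnn 4 * lnn 2)) (N%:R * lnn N) => u v.
move: (lnn N) (lnn 2) l2 lN NR350 => y x; rewrite -mulr_natl.
move: (N%:R : R) => z; lra.
Qed.

End Mertens.

(** * Mertens' bound below 350 by integer computation *)

Lemma nat_of_binX x k : nat_of_bin (BinNat.N.pow x k) = (nat_of_bin x ^ nat_of_bin k)%N.
Proof.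
elim/BinNat.N.peano_ind: k => [|k IH]; first by rewrite BinNat.N.pow_0_r.
have -> : nat_of_bin (BinNat.N.succ k) = (nat_of_bin k).+1 by lia.
by rewrite BinNat.N.pow_succ_r' expnS -IH; lia.
Qed.

(* The binary integers make the sixteenth power computable; the exponent 16
   gives the logarithm to base 2 within 1/16, accurate enough below. *)
Definition log2_16 (n : nat) : nat :=
  nat_of_bin (BinNat.N.log2 (BinNat.N.pow (bin_of_nat n) (bin_of_nat 16))).

Lemma log2_16_bounds n : (0 < n)%N ->
  (2 ^ log2_16 n <= n ^ 16 < 2 ^ (log2_16 n).+1)%N.
Proof.
move=> n0; set x := BinNat.N.pow (bin_of_nat n) (bin_of_nat 16).
have xE : nat_of_bin x = (n ^ 16)%N by rewrite nat_of_binX !bin_of_natK.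
have x0 : (0 < nat_of_bin x)%N by rewrite xE expn_gt0 n0.
have [] := BinNat.N.log2_spec x; first by lia.
rewrite -xE; set a := BinNat.N.pow _ (BinNat.N.log2 x).
set b := BinNat.N.pow _ (BinNat.N.succ _).
have <- : nat_of_bin a = (2 ^ log2_16 n)%N by rewrite nat_of_binX.
have <- : nat_of_bin b = (2 ^ (log2_16 n).+1)%N.
  by rewrite nat_of_binX; congr (_ ^ _)%N; rewrite /log2_16 -/x; lia.
by lia.
Qed.

(* An upper bound, in units of [ln 2 / 1024], for [L q / q]. *)
Definition mangoldt_weight (q : nat) : nat :=
  if (1 < q)%N && (q == (pdiv q) ^ (logn (pdiv q) q))%N
  then (((log2_16 (pdiv q)).+1 * 64) %/ q).+1 else 0.

(** In units of ln 2 / 1024, [64 * log2_16 n] is a lower bound for ln n, as 64 * 16 = 1024. The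
    running sum [acc] lets one pass test all cutoffs. *)
Fixpoint mertens_check (k n acc : nat) : bool :=
  if k is k'.+1 then
    let acc' := (mangoldt_weight n + acc)%N in
    (acc' <= 64 * log2_16 n)%N && mertens_check k' n.+1 acc'
  else true.

Lemma mertens_checkP k n acc : (0 < n)%N ->
  acc = (\sum_(1 <= q < n) mangoldt_weight q)%N -> mertens_check k n acc ->
  forall m, (n <= m < n + k)%N ->
  (\sum_(1 <= q < m.+1) mangoldt_weight q <= 64 * log2_16 m)%N.
Proof.
elim: k n acc => [|k IH] n acc n0 accE; first by move=> _ m; lia.
have accS : (mangoldt_weight n + acc)%N
    = (\sum_(1 <= q < n.+1) mangoldt_weight q)%N.
  by rewrite big_nat_recr //= -accE addnC.
cbn [mertens_check]; rewrite accS => /andP[c1 c2] m mnk.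
have [->//|mn] := eqVneq m n.
by apply: (IH n.+1 _ isT erefl c2 m); lia.
Qed.

Lemma mertens_check_349 : mertens_check 349 1 0.
Proof. by vm_compute. Qed.

Section MertensSmall.
Context {R : realType}.
Local Notation L := (@mangoldt R).
Local Notation lnn n := (ln (n%:R : R)).

(** With l = [log2_16 p], p^16 < 2^(l+1) gives 1024 ln p <= 64 (l+1) ln 2; the successor after the
    integer division by q rounds upwards. *)
Lemma mangoldt_weight_ge q : (0 < q)%N ->
  1024 * (L q / q%:R) <= (mangoldt_weight q)%:R * lnn 2.
Proof.
move=> q0; rewrite /mangoldt /mangoldt_weight; case: ifP => [/andP[q1 _]|_].
  set p := pdiv q; set l := log2_16 p.
  have p0 : (0 < p)%N by rewrite prime_gt0 // pdiv_prime.
  have h1 : 16 * lnn p <= l.+1%:R * lnn 2.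
    rewrite !mulr_natl -!lnnX //; apply: ler_lnn; first by rewrite expn_gt0 p0.
    by have /andP[_ /ltnW] := log2_16_bounds p0.
  have h2 : 64 * l.+1%:R <= ((l.+1 * 64) %/ q).+1%:R * q%:R :> R.
    by rewrite mulrC -!natrM ler_nat ltnW // -ltn_divLR.
  rewrite mulrA ler_pdivrMr ?ltr0n // mulrAC.
  have l2 : 0 <= lnn 2 := lnn_ge0 2.
  apply: le_trans (ler_wpM2r l2 h2); rewrite -mulrA.
  move: h1; move: (l.+1%:R * lnn 2) (lnn p) => u v; lra.
by rewrite !mul0r mulr0.
Qed.

Lemma mertens_small N : (0 < N < 350)%N ->
  \sum_(1 <= q < N.+1) L q / q%:R <= lnn N.
Proof.
move=> /andP[N0 N350].
have sum0 : 0%N = (\sum_(1 <= q < 1) mangoldt_weight q)%N by rewrite big_geq.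
have N1 : (1 <= N < 1 + 349)%N by rewrite N0.
have h := mertens_checkP (ltn0Sn 0) sum0 mertens_check_349 N1.
have K0 : 0 < 1024 :> R by lra.
rewrite -(ler_pM2l K0) mulr_sumr.
apply: le_trans (_ : _ <= \sum_(1 <= q < N.+1) (mangoldt_weight q)%:R * lnn 2) _.
  rewrite big_nat [leRHS]big_nat; apply: ler_sum => q /andP[q0 _].
  exact: mangoldt_weight_ge.
rewrite -mulr_suml -natr_sum.
have l2 : 0 <= lnn 2 := lnn_ge0 2.
apply: le_trans (_ : (64 * log2_16 N)%:R * lnn 2 <= _).
  by rewrite ler_wpM2r // ler_nat.
have : lnn (2 ^ log2_16 N) <= lnn (N ^ 16).
  apply: ler_lnn; first by rewrite expn_gt0.
  by have /andP[] := log2_16_bounds N0.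
rewrite !lnnX // natrM -mulrA -[lnn 2 *+ _]mulr_natl -[lnn N *+ _]mulr_natl.
move: (_%:R * lnn 2) (lnn N) => u v; lra.
Qed.

Lemma mertens_le N : (0 < N)%N ->
  \sum_(1 <= q < N.+1) L q / q%:R <= lnn N.
Proof.
move=> N0; have [N350|N350] := ltnP N 350; last exact: mertens_large.
by apply: mertens_small; rewrite N0.
Qed.

End MertensSmall.

(** * Weighted sums over prime powers and the slack at primes *)

Section Inflow.
Context {R : realType}.
Local Notation L := (@mangoldt R).
Local Notation lnn n := (ln (n%:R : R)).

(* By summation by parts, [mertens_le] lets one replace the weight [L q / q] by
   [ln q - ln (q - 1)]; then the sum telescopes, with a gain at [q = 2]. *)
Lemma mangoldt_inflow_le n Q : (1 < n)%N ->
  \sum_(1 <= q < Q.+1) L q / q%:R * (lnn (n * q) ^+ 2)^-1 <=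
  (lnn n)^-1 - lnn 2 ^+ 2 / (lnn n * lnn (2 * n) ^+ 2).
Proof.
move=> n1; set C := leRHS; have n0 := ltnW n1.
(* [ln] takes the value 0 at 0, so v(1) = 0 and the partial sums of v are exactly ln m. *)
pose v q : R := lnn q - lnn q.-1.
pose g q : R := (lnn (n * q) ^+ 2)^-1.
have nq1 q : (0 < q)%N -> (1 < n * q)%N.
  by move=> q0; apply: leq_trans n1 _; rewrite leq_pmulr.
have vg K : \sum_(1 <= q < K.+3) v q * g q <= C - (lnn (n * K.+2))^-1.
  (* At K = 0 only q = 2 counts, and its term ln 2 / ln^2(2n) equals the right side exactly; the
     telescoping estimate starts at q = 3. *)
  elim: K => [|K IH].
    rewrite big_nat_recr //= big_nat1 /v /= ln1 ln0 // subr0 mul0r add0r subr0.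
    rewrite /g /C mulnC lnnM //.
    have x0 : 0 < lnn n := lnn_gt0 n1.
    have y0 : 0 < lnn 2 := lnn_gt0 (isT : 1 < 2)%N.
    move: (lnn n) (lnn 2) x0 y0 => x y x0 y0.
    rewrite le_eqVlt; apply/orP; left; apply/eqP; field.
    by rewrite !gt_eqF //; lra.
  have step : v K.+3 * g K.+3 <= (lnn (n * K.+2))^-1 - (lnn (n * K.+3))^-1.
    have y0 : 0 < lnn (n * K.+2) by rewrite lnn_gt0 // nq1.
    have yz : lnn (n * K.+2) <= lnn (n * K.+3).
      by apply: ler_lnn; rewrite ?leq_pmul2l //; lia.
    have vE : v K.+3 = lnn (n * K.+3) - lnn (n * K.+2).
      by rewrite !lnnM // /v /=; lra.
    rewrite vE /g; move: (lnn (n * K.+2)) (lnn (n * K.+3)) y0 yz => y z y0 yz.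
    have z0 : 0 < z by lra.
    have -> : y^-1 - z^-1 = (z - y) / (y * z) by field; rewrite !gt_eqF.
    rewrite ler_wpM2l ?subr_ge0 // lef_pV2 ?posrE ?mulr_gt0 ?exprn_gt0 //.
    by rewrite expr2 ler_pM2r.
  by rewrite big_nat_recr //=; lra.
have g0 q : 0 <= g q by rewrite invr_ge0 exprn_ge0 ?lnn_ge0.
(* Two nonnegative terms are added because [vg] starts at the cutoff 2. *)
apply: le_trans (_ : _ <= \sum_(1 <= q < Q.+3) L q / q%:R * g q) _.
  have t0 q : 0 <= L q / q%:R * g q.
    by rewrite mulr_ge0 ?divr_ge0 ?mangoldt_ge0 ?ler0n.

  rewrite [leRHS](@big_nat_recr _ _ _ Q.+2) //= (@big_nat_recr _ _ _ Q.+1) //=.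
  by rewrite -addrA lerDl addr_ge0 // t0.
have C2 : (lnn (n * Q.+2))^-1 >= 0 by rewrite invr_ge0 lnn_ge0.
apply: le_trans (_ : _ <= \sum_(1 <= q < Q.+3) v q * g q) _; last first.
  by have := vg Q; lra.
apply: ler_sum_dominated => // [m|m m0].
  have -> : \sum_(1 <= q < m.+1) v q = lnn m.
    by rewrite big_add1 /= sum_lnn_diff // [lnn 0]ln0 // subr0.
  have [->|m0] := posnP m; first by rewrite big_geq // ln0.
  exact: mertens_le.
rewrite lef_pV2 ?posrE ?exprn_gt0 ?lnn_gt0 ?nq1 // lerXn2r ?nnegrE ?lnn_ge0 //.
by apply: ler_lnn; rewrite ?leq_pmul2l ?muln_gt0 ?n0.
Qed.

(** Replace k^2 by 4 and sum the geometric series from k = 2. *)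
Lemma sum_inv_pow_le p K : (1 < p)%N ->
  \sum_(2 <= k < K.+1) ((p ^ k)%:R * k%:R ^+ 2)^-1 <=
  (4 * p%:R * (p%:R - 1))^-1 :> R.
Proof.
move=> p1; have P1 : 1 < p%:R :> R by rewrite ltr1n.
have P0 : 0 < p%:R :> R by lra.
have P10 : 0 < p%:R - 1 :> R by lra.
have geo m : \sum_(2 <= k < m.+2) ((p ^ k)%:R)^-1 =
    (p%:R * (p%:R - 1))^-1 - ((p ^ m.+1)%:R * (p%:R - 1))^-1 :> R.
  elim: m => [|m IH]; first by rewrite big_geq // expn1 subrr.
  rewrite big_nat_recr //= IH !expnS !natrM.
  have : (p ^ m)%:R != 0 :> R by rewrite pnatr_eq0 expn_eq0; lia.
  move: (_ ^ _)%:R => z z0; field.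
  by rewrite z0 !gt_eqF.
apply: le_trans (_ : _ <= \sum_(2 <= k < K.+2) ((p ^ k)%:R)^-1 / 4) _.
  apply: le_trans (_ : _ <= \sum_(2 <= k < K.+2) ((p ^ k)%:R * k%:R ^+ 2)^-1) _.
    case: K => [|K]; first by rewrite !big_geq.
    by rewrite [leRHS]big_nat_recr //= lerDl invr_ge0 mulr_ge0 ?exprn_ge0.
  rewrite big_nat [leRHS]big_nat; apply: ler_sum => k /andP[k2 _].
  rewrite invfM ler_wpM2l ?invr_ge0 // lef_pV2 ?posrE ?exprn_gt0 ?ltr0n //; try lia.
  rewrite -natrX ler_nat -[4%N]/(2 ^ 2)%N leq_exp2r //.
rewrite -mulr_suml geo -mulrA [leRHS]invfM [leRHS]mulrC ler_wpM2r //.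
by rewrite lerBlDr lerDl invr_ge0 mulr_ge0 // ltW.
Qed.

(** By [crit] integers suffice: (2p)^c <= 2^e gives ln(2p) <= (e/c) ln 2, leaving e^2 <= 4 (p-1)
    c^2. At p = 2 equality holds. *)
Lemma lnn_double_sqr_le p : (1 < p)%N ->
  lnn (2 * p) ^+ 2 <= 4 * (p%:R - 1) * lnn 2 ^+ 2.
Proof.
move=> p1.
have crit c e : (0 < c)%N -> ((2 * p) ^ c <= 2 ^ e)%N ->
    (e ^ 2 <= 4 * p.-1 * c ^ 2)%N ->
    lnn (2 * p) ^+ 2 <= 4 * (p%:R - 1) * lnn 2 ^+ 2.
  move=> c0 h1 h2; have C0 : 0 < c%:R :> R by rewrite ltr0n.
  have pE : p%:R - 1 = p.-1%:R :> R by rewrite -{1}(prednK (ltnW p1)) -natr1 addrK.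
  have {}h1 : c%:R * lnn (2 * p) <= e%:R * lnn 2.
    rewrite [c%:R * _]mulr_natl [e%:R * _]mulr_natl -!lnnX ?muln_gt0 //; last by lia.
    by apply: ler_lnn => //; rewrite expn_gt0; lia.
  have {}h2 : e%:R ^+ 2 <= 4 * p.-1%:R * c%:R ^+ 2 :> R.
    by rewrite -!natrX -!natrM ler_nat.
  rewrite -(@ler_pM2l _ (c%:R ^+ 2)) ?exprn_gt0 // -exprMn pE.
  apply: le_trans (_ : _ <= (e%:R * lnn 2) ^+ 2) _.
    by rewrite lerXn2r ?nnegrE ?mulr_ge0 ?lnn_ge0.
  by rewrite exprMn [leRHS]mulrA ler_wpM2r ?exprn_ge0 ?lnn_ge0 // [leRHS]mulrC.
(* For 2^j <= p - 1 < 2^(j+1) the choice c = 1, e = j + 2 works unless j = 1, that is p = 3 or p =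
   4. The case p = 3 is tight: 6^5 <= 2^14 and 14^2 = 196 <= 200. *)
have [p3|p3] := eqVneq p 3; first by apply: (crit 5 14)%N; rewrite ?p3.
have [p4|p4] := eqVneq p 4; first by apply: (crit 1 3)%N; rewrite ?p4.
have t0 : (0 < p.-1)%N by lia.
have /andP[j1 j2] := trunc_log_bounds (isT : 1 < 2)%N t0.
set j := trunc_log 2 p.-1 in j1 j2.
apply: (crit 1 j.+2)%N => //.
  rewrite expn1 expnS leq_pmul2l //; lia.
rewrite exp1n muln1; apply: leq_trans (_ : 4 * 2 ^ j <= _)%N; last by rewrite leq_pmul2l.
have jn1 : j != 1%N by apply/eqP => jE; rewrite jE in j1 j2; lia.
case: j jn1 {j1 j2} => // -[|] // j _.
elim: j => // j IH; rewrite (expnS 2 j.+2).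
by move: (2 ^ j.+2)%N IH => x; rewrite -!mulnn; nia.
Qed.

(** Divided by ln p, the left side is, for prime p, the mass redirected to p from its powers up to
    p^K, and the right side is 1/p times the gain subtracted in [mangoldt_inflow_le] at n = p. *)
Lemma prime_slack p K : (1 < p)%N ->
  \sum_(2 <= k < K.+1) ((p ^ k)%:R * k%:R ^+ 2)^-1 <=
  p%:R^-1 * (lnn 2 ^+ 2 / lnn (2 * p) ^+ 2).
Proof.
move=> p1; apply: le_trans (sum_inv_pow_le K p1) _.
have h := lnn_double_sqr_le p1.
have P1 : 1 < p%:R :> R by rewrite ltr1n.
have l0 : 0 < lnn (2 * p) ^+ 2 by rewrite exprn_gt0 // lnn_gt0 //; lia.
rewrite (mulrC 4) -mulrA invfM ler_wpM2l ?invr_ge0 // ler_pdivlMr //.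
by rewrite mulrC ler_pdivrMr; lra.
Qed.

End Inflow.

(** * The Markov chain *)

(** Suited to the chain, where the mass at n depends on larger indices up to N. *)
Lemma descending_ind N (Q : nat -> Prop) :
  (forall n, (forall m, (n < m <= N)%N -> Q m) -> Q n) -> forall n, Q n.
Proof.
move=> step n; have [k kE] : exists k, k = (N - n)%N by eexists.
elim/ltn_ind: k n kE => k IH n kE; apply: step => m mn.
by apply: (IH (N - m)%N) => //; lia.
Qed.

Section Chain.
Context {R : realType}.
Local Notation L := (@mangoldt R).
Local Notation lnn n := (ln (n%:R : R)).

(* From a composite [n] the chain moves to a proper divisor [m > 1] with
   probability [L (n / m) / ln n]. What is missing to a total mass of 1, namely
   [L n / ln n], occurs only for a prime power [n = p ^ k]; it is sent to [p].
   Primes are absorbing. *)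
Definition chain (n m : nat) : R :=
  if [&& (m %| n)%N, (1 < m)%N & (m < n)%N]
  then (L (n %/ m) + (if m == pdiv n then L n else 0)) / lnn n else 0.

Definition nu (n : nat) : R := (n%:R * lnn n)^-1.

Lemma nu_ge0 n : 0 <= nu n.
Proof. by rewrite invr_ge0 mulr_ge0 ?lnn_ge0. Qed.

Lemma chain_ge0 n m : 0 <= chain n m.
Proof.
rewrite /chain; case: ifP => // _; rewrite mulr_ge0 ?invr_ge0 ?lnn_ge0 //.
by rewrite addr_ge0 ?mangoldt_ge0 //; case: ifP => // _; exact: mangoldt_ge0.
Qed.

Lemma chain_neq0 n m : chain n m != 0 -> [&& (m %| n)%N, (1 < m)%N & (m < n)%N].
Proof. by rewrite /chain; case: ifP => //; rewrite eqxx. Qed.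

Lemma chain_prime p m : prime p -> chain p m = 0.
Proof.
move=> pp; apply/eqP/negPn/negP => /chain_neq0 /and3P[mp m1 mltp].
by move: (mp); rewrite dvdn_prime2 ?(pdiv_prime m1) //; case/primeP: pp => _ /(_ _ mp); lia.
Qed.

(** The involution sending m to n/m permutes the divisors of n. *)
Lemma sum_dvd_codivisor (F : nat -> R) n N : (0 < n <= N)%N ->
  \sum_(1 <= m < N.+1 | (m %| n)%N) F (n %/ m)%N =
  \sum_(1 <= m < N.+1 | (m %| n)%N) F m.
Proof.
move=> /andP[n0 nN]; rewrite -big_filter -[RHS]big_filter.
set s := [seq m <- _ | _].
have sP m : (m \in s) = (m %| n)%N.
  rewrite mem_filter mem_index_iota; case mn: (m %| n)%N => //=.
  by rewrite (dvdn_gt0 n0 mn) ltnS (leq_trans (dvdn_leq n0 mn)).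
have us : uniq s by rewrite filter_uniq // iota_uniq.
have inv m : m \in s -> (n %/ (n %/ m) = m)%N.
  by rewrite sP => mn; rewrite divnA // mulKn.
rewrite -(big_map (fun m => n %/ m)%N xpredT F); apply: perm_big.
apply: uniq_perm => //.
  by rewrite map_inj_in_uniq // => x y xs ys e; rewrite -(inv x) // e inv.
move=> m; apply/mapP/idP => [[x xs ->]|ms].
  by move: xs; rewrite !sP => xn; rewrite dvdn_div // dvdn_divRL // dvdn_mulr.
exists (n %/ m)%N; last by rewrite inv.
by move: ms; rewrite !sP => xn; rewrite dvdn_div.
Qed.

(** After multiplication by ln n the sum is that of L(n/m) over the divisors m > 1, plus L(n) from
    the correction at [pdiv n], which stands in for the missing divisor 1. *)
Lemma chain_stochastic n N : (1 < n <= N)%N -> ~~ prime n ->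
  \sum_(2 <= m < N.+1) chain n m = 1.
Proof.
move=> /andP[n1 nN] np; have ln0 : lnn n != 0 by rewrite gt_eqF ?lnn_gt0.
pose p := pdiv n; have pp : prime p := pdiv_prime n1.
have pn : (p < n)%N.
  rewrite ltn_neqAle dvdn_leq ?pdiv_dvd ?(ltnW n1) // andbT.
  by apply: contraNneq np => <-.
have E m : (1 < m)%N -> chain n m * lnn n =
    ((if (m %| n)%N then L (n %/ m) else 0) + (if p == m then L n else 0)).
  move=> m1; rewrite /chain m1 /= [p == m]eq_sym.
  have [mn|mn] := boolP (m %| n)%N; last first.
    rewrite mul0r; case: eqP => [mp|]; last by rewrite addr0.
    by rewrite mp pdiv_dvd in mn.
  have [mltn|] /= := ltnP m n; first by rewrite divfK.
  move=> nm; have -> : m = n by apply/eqP; rewrite eqn_leq nm dvdn_leq // ltnW.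
  by rewrite divnn (ltnW n1) mangoldt1 mul0r (gtn_eqF pn) addr0.
apply: (mulIf ln0); rewrite mul1r mulr_suml big_nat.
under eq_bigr => m /andP[m1 _] do rewrite E //.
rewrite -big_nat big_split /= (sum_nat_pred1 (fun=> L n)); last first.
  by rewrite prime_gt1 //= ltnS (leq_trans (ltnW pn)).
have n0N : (0 < n <= N)%N by rewrite ltnW.
rewrite -[RHS](@sum_mangoldt_dvd _ _ N) // -sum_dvd_codivisor //.
by rewrite [RHS]big_mkcond /= [RHS]big_ltn ?dvd1n ?divn1 1?addrC //; lia.
Qed.

(** Each positive F(m) is charged to some q with f(q) = m; since q determines m, no q is charged
    twice. *)
Lemma ler_sum_image (F G : nat -> R) (f : nat -> nat) a b c d :
  (forall q, (c <= q < d)%N -> 0 <= G q) ->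
  (forall m, (a <= m < b)%N ->
     F m <= 0 \/ exists q, [/\ (c <= q < d)%N, m = f q & F m <= G q]) ->
  \sum_(a <= m < b) F m <= \sum_(c <= q < d) G q.
Proof.
move=> G0 FG.
apply: le_trans (_ : _ <=
    \sum_(a <= m < b) \sum_(c <= q < d) if f q == m then G q else 0) _.
  rewrite big_nat [leRHS]big_nat; apply: ler_sum => m mab.
  have t0 : forall q, (c <= q < d)%N -> 0 <= if f q == m then G q else 0.
    by move=> q qcd; case: ifP => // _; exact: G0.
  have [Fm|[q [qcd mE Fm]]] := FG m mab.
    by apply: le_trans Fm _; rewrite big_nat; apply: sumr_ge0 => q /t0.
  apply: le_trans Fm _; rewrite (bigD1_seq q) ?iota_uniq ?mem_index_iota //=.
  rewrite mE eqxx lerDl big_seq_cond; apply: sumr_ge0 => i.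
  by rewrite mem_index_iota => /andP[/t0]; rewrite mE.
rewrite exchange_big /= big_nat [leRHS]big_nat; apply: ler_sum => q qcd.
have [fq|fq] := boolP (a <= f q < b)%N.
  by rewrite (sum_nat_pred1 (fun=> G q)).
rewrite big_nat big1 ?G0 // => m mab; case: eqP => // e.
by rewrite e mab in fq.
Qed.

(** The inflow splits into [A], from the multiples m = nq, and [B], the corrections sent from powers
    of a prime n. [mangoldt_inflow_le] bounds A by nu(n) less a gain, and [prime_slack] fits B into
    that gain. *)
Lemma chain_subinvariant n N : (1 < n)%N ->
  \sum_(2 <= m < N.+1) nu m * chain m n <= nu n.
Proof.
move=> n1; have n0 := ltnW n1.
pose A m : R := if (n %| m)%N then nu m * (L (m %/ n) / lnn m) else 0.
pose B m : R := if (n < m)%N && (n == pdiv m) then nu m * (L m / lnn m) else 0.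
have AB m : nu m * chain m n <= A m + B m.
  have A0 : 0 <= A m.
    by rewrite /A; case: ifP => // _; rewrite !mulr_ge0 ?nu_ge0 ?invr_ge0 ?lnn_ge0
      ?mangoldt_ge0.
  have B0 : 0 <= B m.
    by rewrite /B; case: ifP => // _; rewrite !mulr_ge0 ?nu_ge0 ?invr_ge0 ?lnn_ge0
      ?mangoldt_ge0.
  rewrite /chain; case: ifP; last by rewrite mulr0 addr_ge0.
  move=> /and3P[nm _ ltnm]; rewrite /A /B nm ltnm /= mulrDl mulrDr lerD2l.
  by case: ifP => // _; rewrite mul0r mulr0.
apply: le_trans (ler_sum _ _) _; first by move=> m _; exact: AB.
rewrite big_split /=.
have SA : \sum_(2 <= m < N.+1) A m <=
    n%:R^-1 * ((lnn n)^-1 - lnn 2 ^+ 2 / (lnn n * lnn (2 * n) ^+ 2)).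
  have ninv0 : 0 < n%:R^-1 :> R by rewrite invr_gt0 ltr0n.
  have h := mangoldt_inflow_le N n1 : _ <= _ :> R.
  rewrite -(ler_pM2l ninv0) in h; apply: le_trans h.
  rewrite mulr_sumr; apply: (ler_sum_image (f := muln n)).
    move=> q _; rewrite !mulr_ge0 ?invr_ge0 ?mangoldt_ge0 //.
    by rewrite exprn_ge0 ?lnn_ge0.
  move=> m /andP[m2 mN]; rewrite /A; case: ifP => [nm|_]; last by left.
  right; exists (m %/ n)%N; have mE : m = (n * (m %/ n))%N by rewrite mulnC divnK.
  have m0 : (0 < m)%N by lia.
  split=> //.
    rewrite divn_gt0 // dvdn_leq //= ltnS (leq_trans (leq_div _ _)) //.
  rewrite -mE le_eqVlt; apply/orP; left; apply/eqP.
  rewrite /nu {1}mE natrM.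
  have : lnn m != 0 by rewrite gt_eqF // lnn_gt0.
  have : (m %/ n)%:R != 0 :> R by rewrite pnatr_eq0 -lt0n divn_gt0 // dvdn_leq.
  have : n%:R != 0 :> R by rewrite pnatr_eq0 -lt0n.
  move: (L _) (lnn m) (n%:R : R) ((m %/ n)%:R : R) => x y z w z0 w0 y0.
  by field; rewrite y0 z0 w0.
have SB : \sum_(2 <= m < N.+1) B m <=
    n%:R^-1 * (lnn 2 ^+ 2 / (lnn n * lnn (2 * n) ^+ 2)).
  have [np|nnp] := boolP (prime n); last first.
    rewrite big_nat big1.
      by rewrite !(mulr_ge0, invr_ge0, exprn_ge0, lnn_ge0).
    move=> m /andP[m2 _]; rewrite /B; case: eqP => [e|]; last by rewrite andbF.
    by rewrite e pdiv_prime in nnp.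
  have l0 := lnn_gt0 n1 : 0 < lnn n.
  have h := prime_slack N n1 : _ <= _ :> R.
  have linv0 : 0 < (lnn n)^-1 by rewrite invr_gt0.
  rewrite -(ler_pM2l linv0) in h.
  have -> : n%:R^-1 * (lnn 2 ^+ 2 / (lnn n * lnn (2 * n) ^+ 2)) =
      (lnn n)^-1 * (n%:R^-1 * (lnn 2 ^+ 2 / lnn (2 * n) ^+ 2)).
    by rewrite (invfM (lnn n)); ring.
  apply: le_trans h; rewrite mulr_sumr.
  apply: (ler_sum_image (f := expn n)) => [q _|m /andP[m2 mN]].
    by rewrite mulr_ge0 ?invr_ge0 ?mulr_ge0 ?exprn_ge0 // ltW.
  rewrite /B; case: ifP; last by left.
  move=> /andP[nm /eqP nE]; have [L0|/mangoldt_neq0[p [k [pp mE]]]] := eqVneq (L m) 0.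
    by left; rewrite L0 mul0r mulr0.
  right; exists k.+1; have pE : p = n by rewrite nE mE pdiv_pfactor.
  rewrite pE in mE pp; split=> //.
    case: k mE => [|k] mE; first by rewrite mE expn1 ltnn in nm.
    by rewrite /= ltnS -ltnS (leq_trans _ mN) // mE ltnS ltnW // ltn_expl.
  rewrite /nu mE mangoldt_pfactor // lnnX // -[_ *+ k.+1]mulr_natl.
  rewrite le_eqVlt; apply/orP; left; apply/eqP.
  have : (n ^ k.+1)%:R != 0 :> R by rewrite pnatr_eq0 expn_eq0; lia.
  have : k.+1%:R != 0 :> R by rewrite pnatr_eq0.
  move: l0; move: (lnn n) (k.+1%:R : R) ((n ^ k.+1)%:R : R) => x y z x0 y0 z0.
  by field; rewrite y0 z0 gt_eqF.
apply: le_trans (lerD SA SB) _; rewrite -mulrDr subrK /nu invfM //.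
Qed.

End Chain.

(** * The flow started on a primitive set *)

Section Flow.
Context {R : realType}.
Local Notation chain := (@chain R).
Local Notation nu := (@nu R).

(** The chain strictly decreases, so the system is triangular and can be solved downwards from N.
    With starting masses [c], [mu n] is the total mass passing through n. *)
Lemma flow_exists (c : nat -> R) N : exists mu : nat -> R,
  forall n, (0 < n)%N -> mu n = c n + \sum_(2 <= m < N.+1) mu m * chain m n.
Proof.
have [mu muE] : exists mu : nat -> R,
    forall n, mu n = c n + \sum_(n.+1 <= m < N.+1) mu m * chain m n.
  suff H k : exists mu : nat -> R, forall n, (N < n + k)%N ->
      mu n = c n + \sum_(n.+1 <= m < N.+1) mu m * chain m n.
    by have [mu muE] := H N.+1; exists mu => n; apply: muE; lia.
  elim: k => [|k [mu IH]].
    by exists c => n nN; rewrite big_geq ?addr0 //; lia.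
  (* Only the value at N - k changes; the equations from there on use [mu] only at larger
     indices. *)
  pose mu' n := if (n + k == N)%N
    then c n + \sum_(n.+1 <= m < N.+1) mu m * chain m n else mu n.
  exists mu' => n nN.
  have -> : \sum_(n.+1 <= m < N.+1) mu' m * chain m n =
            \sum_(n.+1 <= m < N.+1) mu m * chain m n.
    rewrite big_nat [RHS]big_nat; apply: eq_bigr => m /andP[nm _].
    by rewrite /mu' ifF //; lia.
  by rewrite /mu'; case: eqP => // nkN; apply: IH; lia.
exists mu => n n0; rewrite muE; congr (_ + _).
have [nN|nN] := leqP n N; last first.
  rewrite big_geq 1?ltnW // big_nat big1 // => m /andP[_ mN].
  have [->|/chain_neq0/and3P[_ _]] := eqVneq (chain m n) 0; first by rewrite mulr0.
  by lia.
rewrite [RHS](@big_cat_nat _ _ _ n.+1) //= [X in _ = X + _]big_nat.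
rewrite [X in _ = X + _]big1 ?add0r // => m /andP[_ mN].
have [->|/chain_neq0/and3P[_ _]] := eqVneq (chain m n) 0; first by rewrite mulr0.
by lia.
Qed.

Lemma primitive_sum_le (F : pred nat) N :
  (forall a, F a -> (1 < a)%N) ->
  (forall a b, F a -> F b -> (a %| b)%N -> a = b) ->
  \sum_(2 <= n < N.+1 | F n) nu n <= \sum_(2 <= n < N.+1 | prime n) nu n.
Proof.
move=> F1 Fprim; pose c n : R := if F n then nu n else 0.
have [mu muE] := flow_exists c N.
(* A proper multiple of a member of F is no starting point, by primitivity, and is entered only from
   its own proper multiples. *)
have mu0 n a : F a -> (a %| n)%N -> (a < n)%N -> mu n = 0.
  elim/(@descending_ind N): n => n IH Fa an altn.
  rewrite muE; last by lia.
  rewrite /c ifN ?add0r; last first.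
    by apply/negP => /(Fprim _ _ Fa)/(_ an) aE; rewrite aE ltnn in altn.
  rewrite big_nat big1 // => m /andP[_ mN].
  have [->|/chain_neq0/and3P[nm _ ltnm]] := eqVneq (chain m n) 0.
    by rewrite mulr0.
  by rewrite (IH m) ?mul0r ?(ltn_trans altn) ?(dvdn_trans an) // ltnm -ltnS.
(* A member of F has no inflow by [mu0], so it carries exactly nu(n). Elsewhere the mass is all
   inflow, hence at most the inflow under nu, which is at most nu(n). *)
have mu_nu n : (1 < n)%N -> 0 <= mu n <= nu n.
  elim/(@descending_ind N): n => n IH n1.
  have S0 m : (2 <= m < N.+1)%N ->
      0 <= mu m * chain m n <= nu m * chain m n.
    move=> /andP[m1 mN].
    have [->|/chain_neq0/and3P[_ _ nm]] := eqVneq (chain m n) 0.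
      by rewrite !mulr0 lexx.
    have /andP[h1 h2] : 0 <= mu m <= nu m by apply: IH => //; rewrite nm.
    by rewrite mulr_ge0 ?chain_ge0 // ler_wpM2r ?chain_ge0.
  rewrite muE ?(ltnW n1) // /c; case: ifP => Fn.
    rewrite big_nat big1 ?addr0 ?lexx ?nu_ge0 // => m /andP[_ mN].
    have [->|/chain_neq0/and3P[nm _ ltnm]] := eqVneq (chain m n) 0.
      by rewrite mulr0.
    by rewrite (@mu0 m n) ?mul0r.
  rewrite add0r; apply/andP; split.
    by rewrite big_nat; apply: sumr_ge0 => m /S0/andP[].
  apply: le_trans (chain_subinvariant N n1).
  by rewrite big_nat [leRHS]big_nat; apply: ler_sum => m /S0/andP[].
(* Sum the balance equation over 2, ..., N: composites pass on their whole mass and primes none, so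
   the composite part cancels. *)
have mass : \sum_(2 <= n < N.+1 | prime n) mu n = \sum_(2 <= n < N.+1 | F n) nu n.
  rewrite [RHS]big_mkcond /= -/c.
  have E : \sum_(2 <= n < N.+1) mu n = \sum_(2 <= n < N.+1) c n +
      \sum_(2 <= m < N.+1 | ~~ prime m) mu m.
    rewrite big_nat; under eq_bigr => n /andP[n1 _] do rewrite muE ?(ltnW n1) //.
    rewrite -big_nat big_split /= exchange_big /=; congr (_ + _).
    rewrite [RHS]big_mkcond big_nat [RHS]big_nat; apply: eq_bigr => m mN.
    rewrite -mulr_sumr; case: ifP => [np|/negbFE pm].
      by rewrite chain_stochastic ?mulr1.
    by rewrite big1 ?mulr0 // => n _; rewrite chain_prime.
  by move: E; rewrite (bigID prime) /= => /addIr.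
rewrite -mass big_nat_cond [leRHS]big_nat_cond.
by apply: ler_sum => n /andP[/andP[n1 _] _]; have /andP[] := mu_nu n n1.
Qed.

End Flow.

(** * From finite sums to series *)

Theorem theorem1p2 (R : realType) (A : set nat) :
  primitive_set A -> (ferdos R A <= ferdos R primes_set)%E.
Proof.
move=> [A1 Aprim].
have nu_nonneg n : (0 <= (@nu R n)%:E)%E by rewrite lee_fin nu_ge0.
have series (P : pred nat) :
    ferdos R [set n | P n]%classic = (\sum_(n <oo | P n) (@nu R n)%:E)%E.
  by rewrite nneseries_esum.
have partial (P : pred nat) N : (forall n, P n -> (1 < n)%N) ->
    (\sum_(0 <= n < N | P n) (@nu R n)%:E)%E =
    (\sum_(2 <= n < N | P n) @nu R n)%:E.
  move=> P1; rewrite sumEFin (@big_nat_widenl _ _ _ 2 0) //; congr EFin.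
  by apply: eq_bigl => n; case Pn: (P n) => //=; rewrite P1.
have -> : A = [set n | `[< A n >]]%classic.
  by apply/seteqP; split=> n /= /asboolP.
rewrite (_ : primes_set = [set n | prime n]%classic) // !series.
(* Each partial sum for A is at most the sum over primes with the same cutoff, hence at most the
   full sum over primes. *)
apply: lime_le; first exact: is_cvg_nneseries.
apply: nearW => -[|N]; first by rewrite big_geq // nneseries_ge0.
apply: le_trans (nneseries_lim_ge N.+1 _) => //.
rewrite !partial; try by [move=> n /prime_gt1|move=> n /asboolP/A1].
rewrite lee_fin; apply: primitive_sum_le => [a /asboolP/A1 //|a b].
by move=> /asboolP Aa /asboolP Ab; apply: Aprim.
Qed.
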